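(* Write $[s_1,s_2,s_3,s_4,s_5,s_6]$ for the permutation $\sigma\in S_6$ with $\sigma(i)=s_i$ for $1\le i\le 6$. Then the set $$\mathcal{M}_6=\left\{\sigma\in S_6/H_6 \;\middle|\; \exists\, a\in\mathcal{A}_6\ \text{such that}\ \forall \mu\in S_6/H_6,\ w(A_\sigma)\le w(A_\mu)\right\}$$ consists of exactly the following five permutations: $$[1,5,3,4,2,6],\quad [1,4,5,3,2,6],\quad [1,5,4,3,2,6],\quad [1,5,4,2,3,6],\quad [1,4,5,2,3,6].$$
   Context: $\mathcal{A}_6$ is the set of $a=(a_1,\dots,a_6)\in\mathbb{R}^6$ with $0\le a_1<a_2<\cdots<a_6$. For $a\in\mathcal{A}_6$ and $\sigma\in S_6$ (the symmetric group on $\{1,\dots,6\}$), $A_\sigma$ is the $6\times 6$ matrix acting on $\mathbb{C}^6$ whose $(i,i+1)$ entry is $a_{\sigma(i)}$ for $1\le i\le 5$, whose $(6,1)$ entry is $a_{\sigma(6)}$, and whose other entries are $0$. The numerical radius of a matrix $A$ is $w(A)=\sup\{|\langle Ax,x\rangle| : \|x\|=1\}$. $H_6$ is the subgroup of $S_6$ generated by $c_6$ (with $c_6(1)=6$ and $c_6(k)=k-1$ for $2\le k\le 6$) and $m_6$ (with $m_6(k)=7-k$). $S_6/H_6$ is the set of cosets $\sigma H_6$; the number $w(A_\sigma)$ depends only on the coset of $\sigma$. Each coset contains exactly one permutation $\sigma$ with $\sigma(1)=1$ and $\sigma(2)<\sigma(6)$, and $S_6/H_6$ is identified with the set of these 60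 representatives. *)

(* Defs.v *)
From HB Require Import structures.
From mathcomp Require Import all_boot all_order all_algebra all_fingroup.
From mathcomp Require Import complex.
From mathcomp Require Import mathcomp_extra boolp classical_sets reals.

Set Implicit Arguments.
Unset Strict Implicit.
Unset Printing Implicit Defensive.

Import Order.TTheory GRing.Theory Num.Theory.

Local Open Scope ring_scope.
Local Open Scope complex_scope.

(* All indices are shifted by one: the mathematical set {1,...,6} is
   'I_6 = {0,...,5}. *)

Definition inner (R : realType) n (x y : 'cV[R[i]]_n) : R[i] :=
  \sum_i x i 0 * (y i 0)^*%R.

Definition norm2 (R : realType) n (x : 'cV[R[i]]_n) : R :=
  Num.sqrt (\sum_i Normc.normc (x i 0) ^+ 2).

Definition numerical_radius (R : realType) n (A : 'M[R[i]]_n) : R :=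
  sup [set Normc.normc (inner (A *m x) x)
      | x in [set x : 'cV[R[i]]_n | norm2 x = 1]]%classic.

Definition A6 (R : realType) : set 'rV[R]_6 :=
  [set a | 0 <= a 0 0 /\ forall i j : 'I_6, (i < j)%N -> a 0 i < a 0 j]%classic.

(* [ordS i] is the cyclic successor, so the nonzero positions are
   (i, i+1) and (5, 0). *)
Definition shift_mx (R : realType) (a : 'rV[R]_6) (s : 'S_6) : 'M[R[i]]_6 :=
  \matrix_(i, j) if j == ordS i then (a 0 (s i))%:C else 0.

(* [ord_pred] is the cyclic predecessor and [rev_ord k] is 5 - k. *)
Definition c6 : 'S_6 := perm (@ord_pred_inj 6).
Definition m6 : 'S_6 := perm (@rev_ord_inj 6).

Definition H6 : {group 'S_6} := <<[set c6; m6]>>%G.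

(* MathComp composes permutations from left to right, (h * s) i = s (h i), so
   the coset s H6 for the usual composition is the right coset H6 :* s.  The
   set S_6 / H_6 is identified with the following representatives; see
   [S6modH6_transversal]. *)
Definition S6modH6 : {set 'S_6} :=
  [set s : 'S_6 | (s 0 == 0) && (s 1%R < s (inord 5))%N]%SET.

Definition M6 (R : realType) : set 'S_6 :=
  [set s | s \in S6modH6 /\
     exists a : 'rV[R]_6, A6 a /\
       forall mu, mu \in S6modH6 ->
         numerical_radius (shift_mx a s) <= numerical_radius (shift_mx a mu)
  ]%classic.

Definition oneline_ffun (s1 s2 s3 s4 s5 s6 : nat) : {ffun 'I_6 -> 'I_6} :=
  [ffun i : 'I_6 => inord (nth 0%N [:: s1; s2; s3; s4; s5; s6] i).-1].

(* The permutation written s1 ... s6 in one-line notation with entries in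
   {1,...,6}; the default value 1 is used only when the entries are not a
   rearrangement of 1,...,6 (see [onelineE]). *)
Definition oneline (s1 s2 s3 s4 s5 s6 : nat) : 'S_6 :=
  insubd (1%g : 'S_6) (oneline_ffun s1 s2 s3 s4 s5 s6).

Lemma onelineE s1 s2 s3 s4 s5 s6 (i : 'I_6) :
  perm_eq [:: s1; s2; s3; s4; s5; s6] (iota 1 6) ->
  (oneline s1 s2 s3 s4 s5 s6 i).+1 = nth 0%N [:: s1; s2; s3; s4; s5; s6] i.
Proof.
rewrite /oneline /oneline_ffun; set l := [:: s1; _; _; _; _; _] => pl.
have szl : size l = 6%N by [].
have ul : uniq l by rewrite (perm_uniq pl).
have lb (j : 'I_6) : (0 < nth 0%N l j < 7)%N.
  have : nth 0%N l j \in iota 1 6 by rewrite -(perm_mem pl) mem_nth ?szl.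
  by rewrite mem_iota.
have vE (j : 'I_6) : ((inord (nth 0%N l j).-1 : 'I_6) : nat).+1 = nth 0%N l j.
  by have /andP[l0 l7] := lb j; rewrite inordK ?prednK.
have inj : injectiveb [ffun j : 'I_6 => inord (nth 0%N l j).-1 : 'I_6].
  apply/injectiveP => j k; rewrite !ffunE => /(congr1 (fun x : 'I_6 => x.+1)).
  by rewrite !vE => /eqP; rewrite nth_uniq ?szl // => /eqP/val_inj.
by rewrite -pvalE [pval _](insubdK (1%g : 'S_6) inj) ffunE vE.
Qed.

Lemma H6_form (h : 'S_6) : h \in H6 ->
  exists b : bool, forall i, h i = h 0 + (-1) ^+ b * i.
Proof.
pose D := [set g : 'S_6 | [exists b : bool,
  [forall i, g i == g 0 + (-1) ^+ b * i]]]%SET.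
have gD : group_set D.
  apply/group_setP; split.
    rewrite inE; apply/existsP; exists false; apply/forallP => i.
    by rewrite !perm1 add0r mul1r.
  move=> g k; rewrite !inE => /existsP[b /forallP gb] /existsP[e /forallP ke].
  apply/existsP; exists (e (+) b); apply/forallP => i.
  rewrite !permM (eqP (ke (g i))) (eqP (ke (g 0))) (eqP (gb i)) mulrDr addrA.
  by rewrite mulrA signr_addb.
have sHD : H6 \subset Group gD.
  rewrite gen_subG; apply/fintype.subsetP => g /set2P[] ->; rewrite inE; apply/existsP.
    exists false; apply/forallP => i; rewrite !permE; apply/eqP/val_inj.
    by case: i => -[|[|[|[|[|[|]]]]]].
  exists true; apply/forallP => i; rewrite !permE; apply/eqP/val_inj.
  by case: i => -[|[|[|[|[|[|]]]]]].
by move=> /(fintype.subsetP sHD); rewrite inE => /existsP[b /forallP hb]; exists b => i;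
  apply/eqP.
Qed.

Lemma c6X k (i : 'I_6) : (c6 ^+ k)%g i = i - inZp k.
Proof.
elim: k => [|k IH].
  by rewrite expg0 perm1; apply/val_inj; case: i => -[|[|[|[|[|[|]]]]]].
rewrite expgSr permM IH permE.
have -> : (inZp k.+1 : 'I_6) = inZp k + 1.
  by apply/val_inj; rewrite /= modnDml addn1.
rewrite opprD addrA; set j := i - _.
by apply/val_inj; case: j => -[|[|[|[|[|[|]]]]]].
Qed.

Lemma S6modH6_transversal :
  is_transversal S6modH6 (rcosets H6 [set: 'S_6]) [set: 'S_6].
Proof.
apply/and3P; split; first exact: (rcosets_partition (finset.subsetT _)).
  exact: finset.subsetT.
have cH : c6 \in H6 by rewrite mem_gen // finset.set21.
have mH : m6 \in H6 by rewrite mem_gen // finset.set22.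
apply/forall_inP => _ /rcosetsP[s _ ->].
have [s0 s0H s00] : exists2 s0, s0 \in (H6 :* s)%g & s0 0 = 0.
  exists ((c6 ^+ (6 - s^-1%g 0%R)%N) * s)%g.
    by rewrite mem_rcoset mulgK groupX.
  rewrite permM c6X sub0r -[RHS](permKV s); congr (s _).
  by case: (s^-1%g 0) => -[|[|[|[|[|[|]]]]]] ? //; apply/val_inj.
have [t tH tR] : exists2 t, t \in (H6 :* s)%g & t \in S6modH6.
  have [lt|] := boolP (s0 1%R < s0 (inord 5))%N.
    by exists s0 => //; rewrite inE s00 eqxx.
  rewrite -leqNgt => le; exists (m6 * c6 ^+ 5 * s0)%g.
    move: s0H; rewrite !mem_rcoset -mulgA => s0H.
    by do 2?[apply: groupM => //]; exact: groupX.
  have E (i : 'I_6) : (m6 * c6 ^+ 5)%g i = - i.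
    rewrite permM c6X permE; apply/val_inj.
    by case: i => -[|[|[|[|[|[|]]]]]].
  rewrite inE 3!(permM (m6 * c6 ^+ 5)%g) !E oppr0 s00 eqxx /=.
  have e5 : - (1 : 'I_6) = inord 5 by apply/val_inj; rewrite /= inordK.
  rewrite -e5 opprK e5 ltn_neqAle le andbT.
  apply/eqP => /val_inj/perm_inj/(congr1 val) /=; rewrite inordK //.
apply/cards1P; exists t; apply/setP => u; rewrite !inE.
apply/andP/eqP => [[uR uH]|->]; last by split=> //; move: tR; rewrite inE.
move: tR uR; rewrite inE => /andP[/eqP t0 tlt] /andP[/eqP u0 ult].
pose h := (u * t^-1)%g.
have hH : h \in H6.
  rewrite /h; have /rcosetP[x xH ->] : u \in (H6 :* s)%g by [].
  have /rcosetP[y yH ->] := tH.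
  by rewrite invMg mulgA mulgK groupM ?groupV.
have uE : u = (h * t)%g by rewrite /h mulgKV.
have h0 : h 0 = 0 by rewrite permM u0 -[in LHS]t0 permK.
have [b hb] := H6_form hH.
clearbody h; case: b hb => hb.
  have e5 : - (1 : 'I_6) = inord 5 by apply/val_inj; rewrite /= inordK.
  move: ult; rewrite uE !permM !(hb 1) !(hb (inord 5)) h0 !add0r -e5.
  by rewrite mulN1r mulrNN mul1r e5 ltnNge (ltnW tlt).
rewrite uE; suff -> : h = 1%g by rewrite mul1g.
by apply/permP => i; rewrite hb h0 add0r mul1r perm1.
Qed.

(* Main.v *)
Require Import Defs.
From mathcomp Require Import all_boot all_order all_algebra all_fingroup.
From mathcomp Require Import complex polyrcf.
From mathcomp Require Import boolp classical_sets reals.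
From mathcomp Require Import ring lra.

(** Let [c i = a_(s i)] be the weights in the order in which they sit on the
    cycle, and [w] the numerical radius.  As the weights are nonnegative, [w] is
    the least [r] such that the real form [\sum_i c_i y_i y_(i+1)] is at most
    [r |y|^2].  A cycle of length 6 is bipartite: splitting [y] into its even
    part [u] and its odd part [v] turns the form into [u^T M v] with [M] of size
    3, so [4 w^2] is the largest eigenvalue of [M M^T], that is, the largest
    root of the cubic [det (x - M M^T)] ([cubic], [cubic_radius],
    [cubic_le0_bound]).  Put [b_i = c_i^2].  Up to terms that do not depend on
    the order of the weights, the linear coefficient of the cubic is

      [(b_0 b_3 + b_2 b_5 + b_4 b_1) - (b_0 + b_2 + b_4) (b_1 + b_3 + b_5)]

    and its constant coefficient is [- (b_0 b_2 b_4 + b_1 b_3 b_5)]; the other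
    two do not depend on the order at all.  So the order matters only through the
    splitting of the weights into the two classes of alternating positions and
    through the pairing of opposite positions [i] and [i + 3].

    Two exchanges make the largest root strictly smaller.
    - If exactly one of [b_0 < b_2] and [b_3 < b_5] holds, exchanging the
      weights at 0 and 2 increases the sum of the products of opposite weights and
      changes nothing else: this is the rearrangement inequality
      ([cubic_swap02]).
    - If the larger weight of the pair [(0, 3)] lies in one class, while for the
      two other opposite pairs it lies in the other class, exchanging the
      weights at 0 and 3 lowers the root ([cubic_swap03]).
    In an optimal arrangement, therefore, the class of the least weight holds
    the smaller weight of each opposite pair, and both classes are increasing
    along the pairs.  These are the standard Young tableaux with two rows of
    length three; there are five of them, and they are the five permutations of
    the theorem ([M6_sub]).

    Conversely, each of the five is optimal for some integer weights.  The
    minimum over the 60 representatives is attained at one of the five, so it is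
    enough to separate the chosen one from the other four: a number [t] is given
    at which the cubics of the four others are nonpositive, while the cubic of
    the chosen one is positive from [t] on ([M6_witness]). *)

Set Implicit Arguments.
Unset Strict Implicit.
Unset Printing Implicit Defensive.

Import Order.TTheory GRing.Theory Num.Theory.

Local Open Scope ring_scope.

Local Notation "[ 'pos' k ]" := (@Ordinal 6 k isT) (at level 0, k at level 9).

Lemma sum6E (V : nmodType) (F : 'I_6 -> V) :
  \sum_i F i =
    F [pos 0] + F [pos 1] + F [pos 2] + F [pos 3] + F [pos 4] + F [pos 5].
Proof.
rewrite !big_ord_recr big_ord0 /= add0r.
by do !congr (_ + _); congr F; apply: val_inj.
Qed.

Lemma ordS6E :
  (ordS [pos 0] = [pos 1]) * (ordS [pos 1] = [pos 2]) *
  (ordS [pos 2] = [pos 3]) * (ordS [pos 3] = [pos 4]) *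
  (ordS [pos 4] = [pos 5]) * (ordS [pos 5] = [pos 0]).
Proof. by do !split; apply: val_inj. Qed.

(** * Ternary quadratic forms and their leading minors *)

Section Form3.
Variables (R : realFieldType) (A B C d e f : R).

Definition form3 x y z : R :=
  A * x ^+ 2 + B * y ^+ 2 + C * z ^+ 2
  - 2 * d * x * y - 2 * e * y * z - 2 * f * x * z.

Definition minor2 : R := A * B - d ^+ 2.

Definition det3 : R :=
  A * B * C - 2 * d * e * f - A * e ^+ 2 - B * f ^+ 2 - C * d ^+ 2.

(** The argument is the last column of the adjugate, shifted by [t] along the
    third axis; the matrix of the form maps that column to [det3] times the
    third basis vector. *)
Lemma form3_adj t :
  form3 (d * e + B * f) (A * e + d * f) (minor2 + t)
  = det3 * minor2 + 2 * t * det3 + C * t ^+ 2.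
Proof. rewrite /form3 /det3 /minor2; ring. Qed.

Lemma form3_gt0_det :
  (forall x y z, (x, y, z) != (0, 0, 0) -> 0 < form3 x y z) -> 0 < det3.
Proof.
move=> q_gt0.
have A_gt0 : 0 < A.
  have := q_gt0 1 0 0; rewrite /form3 !xpair_eqE oner_eq0 => /(_ isT).
  by congr (0 < _); ring.
have m_gt0 : 0 < minor2.
  rewrite -(pmulr_rgt0 _ A_gt0).
  have := q_gt0 d A 0; rewrite !xpair_eqE (gt_eqF A_gt0) andbF => /(_ isT).
  by congr (0 < _); rewrite /form3 /minor2; ring.
rewrite -(pmulr_lgt0 _ m_gt0).
have := q_gt0 (d * e + B * f) (A * e + d * f) (minor2 + 0).
rewrite form3_adj !xpair_eqE addr0 (gt_eqF m_gt0) andbF => /(_ isT).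
by congr (0 < _); ring.
Qed.

Lemma minors_form3_ge0 x y z :
  0 < A -> 0 < minor2 -> 0 < det3 -> 0 <= form3 x y z.
Proof.
move=> A_gt0 m_gt0 D_gt0.
have Am_gt0 := mulr_gt0 A_gt0 m_gt0.
have id : A * minor2 * form3 x y z =
  minor2 * (A * x - d * y - f * z) ^+ 2
  + (minor2 * y - (A * e + d * f) * z) ^+ 2 + A * det3 * z ^+ 2.
  by rewrite /form3 /minor2 /det3; ring.
rewrite -(pmulr_rge0 _ Am_gt0) id; apply: addr_ge0; first apply: addr_ge0.
- exact: mulr_ge0 (ltW m_gt0) (sqr_ge0 _).
- exact: sqr_ge0.
- exact: mulr_ge0 (mulr_ge0 (ltW A_gt0) (ltW D_gt0)) (sqr_ge0 _).
Qed.

Lemma form3_ge0_minors :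
  (forall x y z, 0 <= form3 x y z) -> 0 < det3 -> 0 < A /\ 0 < minor2.
Proof.
move=> q_ge0 D_gt0.
have A_ge0 : 0 <= A by have := q_ge0 1 0 0; congr (0 <= _); rewrite /form3; ring.
have C_ge0 : 0 <= C by have := q_ge0 0 0 1; congr (0 <= _); rewrite /form3; ring.
have m_gt0 : 0 < minor2.
  rewrite ltNge; apply/negP => m_le0.
  have k_gt0 : 0 < C + 1 by rewrite ltr_wpDl.
  (* If minor2 <= 0, the linear term in t of form3_adj makes the form negative
     at the small negative value t = - det3 / (C + 1). *)
  have := q_ge0 (d * e + B * f) (A * e + d * f) (minor2 - det3 / (C + 1)).
  rewrite form3_adj.
  set u := det3 / (C + 1).
  have uE : det3 = u * (C + 1) by rewrite /u divfK // gt_eqF.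
  have u_gt0 : 0 < u by rewrite divr_gt0.
  rewrite {2}uE; apply/negP; rewrite -ltNge.
  have := mulr_ge0 (ltW D_gt0) (_ : 0 <= - minor2).
  rewrite oppr_ge0 => /(_ m_le0).
  have := mulr_ge0 C_ge0 (sqr_ge0 u); have := exprn_gt0 2 u_gt0; nra.
split=> //; rewrite lt_neqAle A_ge0 andbT eq_sym; apply/negP => /eqP A0.
by move: m_gt0; rewrite /minor2 A0 mul0r sub0r oppr_gt0 ltNge sqr_ge0.
Qed.

End Form3.

(** * The cubic of a weighted cycle *)

Section SpectralCubic.
Variable R : rcfType.
Implicit Types (c : 'I_6 -> R) (r s t w : R).

Definition cycle_bound c r := forall y : 'I_6 -> R,
  \sum_i c i * y i * y (ordS i) <= r * \sum_i y i ^+ 2.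

(** This is [det (s - M M^T)], expanded; see [cubic_det3].  Equivalently, the
    characteristic polynomial of the symmetric weighted adjacency matrix of the
    cycle is [cubic c (X ^+ 2)]. *)
Definition cubic c s : R :=
  let b i := c i ^+ 2 in
  s ^+ 3 - (\sum_i b i) * s ^+ 2
  + (b [pos 0] * b [pos 2] + b [pos 2] * b [pos 4] + b [pos 4] * b [pos 0]
     + b [pos 1] * b [pos 3] + b [pos 3] * b [pos 5] + b [pos 5] * b [pos 1]
     + b [pos 0] * b [pos 3] + b [pos 2] * b [pos 5] + b [pos 4] * b [pos 1])
    * s
  - (c [pos 0] * c [pos 2] * c [pos 4] + c [pos 1] * c [pos 3] * c [pos 5]) ^+ 2.

(** The quadratic form of [s - M M^T], in the coordinates of the vertices 0, 2
    and 4 of the cycle; each odd vertex contributes one square to [M M^T], as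
    [gap_formE] shows. *)
Definition gap_form c s : R -> R -> R -> R :=
  form3 (s - c [pos 0] ^+ 2 - c [pos 5] ^+ 2)
        (s - c [pos 1] ^+ 2 - c [pos 2] ^+ 2)
        (s - c [pos 3] ^+ 2 - c [pos 4] ^+ 2)
        (c [pos 0] * c [pos 1]) (c [pos 2] * c [pos 3]) (c [pos 4] * c [pos 5]).

Lemma cubic_det3 c s :
  cubic c s =
  det3 (s - c [pos 0] ^+ 2 - c [pos 5] ^+ 2)
       (s - c [pos 1] ^+ 2 - c [pos 2] ^+ 2)
       (s - c [pos 3] ^+ 2 - c [pos 4] ^+ 2)
       (c [pos 0] * c [pos 1]) (c [pos 2] * c [pos 3]) (c [pos 4] * c [pos 5]).
Proof. rewrite /cubic /det3 sum6E; ring. Qed.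

Lemma gap_formE c s x y z :
  gap_form c s x y z = s * (x ^+ 2 + y ^+ 2 + z ^+ 2)
  - (c [pos 0] * x + c [pos 1] * y) ^+ 2
  - (c [pos 2] * y + c [pos 3] * z) ^+ 2
  - (c [pos 4] * z + c [pos 5] * x) ^+ 2.
Proof. rewrite /gap_form /form3; ring. Qed.

Lemma bound_gap_form_ge0 c w x y z :
  0 < w -> cycle_bound c w -> 0 <= gap_form c (4 * w ^+ 2) x y z.
Proof.
move=> w_gt0; rewrite gap_formE.
set p := c [pos 0] * _ + _; set q := c [pos 2] * _ + _.
set r := c [pos 4] * _ + _.
(* The test vector has even part 2 w u and odd part M^T u, which is extremal
   when u is a top eigenvector of M M^T. *)
move=> /(_ (fun i : 'I_6 =>
  nth 0 [:: 2 * w * x; p; 2 * w * y; q; 2 * w * z; r] i)).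
rewrite !sum6E !ordS6E /= -subr_ge0 => H.
rewrite -(pmulr_rge0 _ w_gt0); move: H; congr (0 <= _); rewrite /p /q /r; ring.
Qed.

Lemma gap_form_ge0_bound c r : 0 < r ->
  (forall x y z, 0 <= gap_form c (4 * r ^+ 2) x y z) -> cycle_bound c r.
Proof.
move=> r_gt0 G y; rewrite !sum6E !ordS6E.
move: (G (y [pos 0]) (y [pos 2]) (y [pos 4])); rewrite gap_formE.
move: (y [pos 0]) (y [pos 1]) (y [pos 2]) (y [pos 3]) (y [pos 4]) (y [pos 5]).
move=> y0 y1 y2 y3 y4 y5.
set p := c [pos 0] * _ + _; set q := c [pos 2] * _ + _.
set k := c [pos 4] * _ + _.
move=> G0; have r4_gt0 : 0 < 4 * r by rewrite mulr_gt0 // ltr0n.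
rewrite -subr_ge0 -(pmulr_rge0 _ r4_gt0).
(* Completing the squares in the odd coordinates. *)
apply: le_trans (_ : 0 <= _ + ((2 * r * y1 - p) ^+ 2 + (2 * r * y3 - q) ^+ 2
   + (2 * r * y5 - k) ^+ 2)) _.
  by apply: (addr_ge0 G0); rewrite !addr_ge0 ?sqr_ge0.
by rewrite le_eqVlt; apply/orP; left; apply/eqP; rewrite /p /q /k; ring.
Qed.

Lemma cubic_le0_bound c w t :
  0 < w -> cycle_bound c w -> cubic c t <= 0 -> t <= 4 * w ^+ 2.
Proof.
move=> w_gt0 cw; apply: contraTT; rewrite -!ltNge => lt_wt.
rewrite cubic_det3; apply: form3_gt0_det => x y z nz.
rewrite -[form3 _ _ _ _ _ _ _ _ _]/(gap_form c t x y z).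
have -> : gap_form c t x y z = gap_form c (4 * w ^+ 2) x y z
    + (t - 4 * w ^+ 2) * (x ^+ 2 + y ^+ 2 + z ^+ 2) by rewrite !gap_formE; ring.
apply: ltr_wpDl; first exact: bound_gap_form_ge0.
rewrite mulr_gt0 ?subr_gt0 // lt_neqAle eq_sym !addr_ge0 ?sqr_ge0 // andbT.
apply: contra nz; rewrite !paddr_eq0 ?addr_ge0 ?sqr_ge0 // !sqrf_eq0 !xpair_eqE.
by [].
Qed.

Lemma poly_gt0_near (p : {poly R}) s : 0 < p.[s] ->
  exists2 d, 0 < d & forall t, `|t - s| < d -> 0 < p.[t].
Proof.
move=> p_gt0; have [d d_gt0 pd] := poly_cont s p p_gt0.
exists d => // t /pd; rewrite ltr_norml => /andP[+ _].
by rewrite ltrBrDr addNr.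
Qed.

(** A positive value at [4 w^2] would make the leading minors of the
    semidefinite gap form positive there, hence also slightly below, which would
    give a bound better than [w].  A negative value there would persist slightly
    above, against [cubic_le0_bound]. *)
Lemma cubic_radius c w : 0 < w -> cycle_bound c w ->
  (forall r, 0 < r -> cycle_bound c r -> w <= r) -> cubic c (4 * w ^+ 2) = 0.
Proof.
move=> w_gt0 cw w_min; set s := 4 * w ^+ 2.
have s_gt0 : 0 < s by rewrite mulr_gt0 ?ltr0n ?exprn_gt0.
have G x y z : 0 <= gap_form c s x y z by exact: bound_gap_form_ge0.
(* The minors are replaced by polynomials known only through their values, so
   that rewriting with their equations cannot unfold them. *)
have linX u v : exists p : {poly R}, forall t, t - u - v = p.[t].
  by exists ('X - (u + v)%:P) => t; rewrite !hornerE opprD addrA.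
have [A AE] := linX (c [pos 0] ^+ 2) (c [pos 5] ^+ 2).
have [B BE] := linX (c [pos 1] ^+ 2) (c [pos 2] ^+ 2).
have [C CE] := linX (c [pos 3] ^+ 2) (c [pos 4] ^+ 2).
pose d := c [pos 0] * c [pos 1]; pose e := c [pos 2] * c [pos 3].
pose f := c [pos 4] * c [pos 5].
have [M ME] : exists p : {poly R}, forall t, minor2 A.[t] B.[t] d = p.[t].
  by exists (A * B - (d ^+ 2)%:P) => t; rewrite !hornerE.
have [D DE] : exists p : {poly R},
    forall t, det3 A.[t] B.[t] C.[t] d e f = p.[t].
  exists (A * B * C - (2 * d * e * f)%:P - A * (e ^+ 2)%:P
    - B * (f ^+ 2)%:P - C * (d ^+ 2)%:P) => t.
  by rewrite !(hornerD, hornerM, hornerN, hornerC).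
have cubicE t : cubic c t = D.[t] by rewrite cubic_det3 AE BE CE -/d -/e -/f DE.
have D_le0 : D.[s] <= 0.
  rewrite leNgt; apply/negP => D_gt0.
  have [A_gt0 M_gt0] : 0 < A.[s] /\ 0 < M.[s].
    rewrite -ME; apply: (@form3_ge0_minors _ _ _ C.[s] _ e f); last by rewrite DE.
    by move=> x y z; move: (G x y z); rewrite /gap_form AE BE CE.
  have [dA dA0 HA] := poly_gt0_near A_gt0.
  have [dM dM0 HM] := poly_gt0_near M_gt0.
  have [dD dD0 HD] := poly_gt0_near D_gt0.
  pose h := Num.min (Num.min dA dM) (Num.min dD s) / 2.
  have h_gt0 : 0 < h by rewrite divr_gt0 ?ltr0n // !lt_min dA0 dM0 dD0 s_gt0.
  have : h < Num.min (Num.min dA dM) (Num.min dD s).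
    by rewrite /h; move: h_gt0; rewrite /h; set m := Num.min _ _; lra.
  rewrite !lt_min => /andP[/andP[hA hM] /andP[hD hs]].
  have near k : h < k -> `|(s - h) - s| < k.
    by rewrite addrAC subrr sub0r normrN gtr0_norm.
  have t_gt0 : 0 < s - h by rewrite subr_gt0.
  pose r := Num.sqrt ((s - h) / 4).
  have r_gt0 : 0 < r by rewrite sqrtr_gt0 divr_gt0 ?ltr0n.
  have rE : 4 * r ^+ 2 = s - h.
    by rewrite sqr_sqrtr ?divr_ge0 ?ler0n ?ltW // mulrC divfK // pnatr_eq0.
  have /(w_min r r_gt0) le_wr : cycle_bound c r.
    apply: gap_form_ge0_bound => // x y z.
    rewrite rE /gap_form AE BE CE; apply: minors_form3_ge0.
    - by apply: HA; apply: near.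
    - by rewrite ME; apply: HM; apply: near.
    - by rewrite DE; apply: HD; apply: near.
  have : s <= s - h.
    by rewrite -rE /s ler_pM2l ?ltr0n // ler_sqr // nnegrE ltW.
  by rewrite lerDl oppr_ge0 leNgt h_gt0.
have : 0 <= D.[s].
  rewrite leNgt; apply/negP => D_lt0.
  have D'_gt0 : 0 < (- D).[s] by rewrite hornerN oppr_gt0.
  have [dl dl0 H] := poly_gt0_near D'_gt0.
  have : cubic c (s + dl / 2) <= 0.
    rewrite cubicE -oppr_ge0 -hornerN ltW // H // addrAC subrr add0r.
    by rewrite gtr0_norm ?divr_gt0 ?ltr0n //; lra.
  move=> /(cubic_le0_bound w_gt0 cw); rewrite -/s; lra.
by rewrite cubicE => ?; apply/eqP; rewrite eq_le D_le0.
Qed.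

Lemma weight_le_bound c w i : cycle_bound c w -> c i <= 2 * w.
Proof.
move=> /(_ (fun k => ((k == i) || (k == ordS i))%:R)); rewrite !sum6E !ordS6E.
case: i => -[|[|[|[|[|[|//]]]]]] p; rewrite (bool_irrelevance p isT) ordS6E /=;
  rewrite /= !(mulr1, mulr0, addr0, add0r, expr1n, expr0n); lra.
Qed.

End SpectralCubic.

(** * The numerical radius as the least bound of a real form *)

Section Radius.
Variable R : realType.
Implicit Types (a : 'rV[R]_6) (s : 'S_6).
Local Open Scope complex_scope.

Lemma normc_norm (z : R[i]) : (Normc.normc z)%:C = `|z|.
Proof. by case: z. Qed.

Lemma inner_shift_mx a s (x : 'cV[R[i]]_6) :
  inner (shift_mx a s *m x) x =
    \sum_i (a 0 (s i))%:C * x (ordS i) 0 * (x i 0)^*%R.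
Proof.
apply: eq_bigr => i _; congr (_ * _); rewrite mxE (bigD1 (ordS i)) //= mxE eqxx.
by rewrite big1 ?addr0 // => j /negPf nj; rewrite mxE nj mul0r.
Qed.

Lemma norm2_eq1 (x : 'cV[R[i]]_6) :
  norm2 x = 1 -> \sum_i Normc.normc (x i 0) ^+ 2 = 1.
Proof.
rewrite /norm2 => /(congr1 (fun r => r ^+ 2)); rewrite sqr_sqrtr ?expr1n //.
by apply: sumr_ge0 => i _; rewrite sqr_ge0.
Qed.

(** Taking absolute values of the coordinates of a vector can only increase the
    form, so real vectors suffice to compute the numerical radius. *)
Lemma inner_shift_mx_le a s (x : 'cV[R[i]]_6) : (forall i, 0 <= a 0 i) ->
  Normc.normc (inner (shift_mx a s *m x) x) <=
    \sum_i a 0 (s i) * Normc.normc (x i 0) * Normc.normc (x (ordS i) 0).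
Proof.
move=> a_ge0; rewrite -lecR normc_norm inner_shift_mx rmorph_sum /=.
apply: le_trans (ler_norm_sum _ _ _) _; apply: ler_sum => i _.
rewrite !normrM norm_conjC !rmorphM /= !normc_norm mulrAC.
by rewrite ger0_norm // lecR.
Qed.

Lemma radius_le a s r : (forall i, 0 <= a 0 i) ->
  cycle_bound (fun i => a 0 (s i)) r -> numerical_radius (shift_mx a s) <= r.
Proof.
move=> a_ge0 ar; apply: sup_le_ub.
  exists (Normc.normc (inner (shift_mx a s *m delta_mx 0 0) (delta_mx 0 0))).
  exists (delta_mx 0 0) => //=; rewrite /norm2 (bigD1 0) //= mxE.
  rewrite Normc.normc1 big1 ?addr0 ?expr1n ?sqrtr1 // => i /negPf ni.
  by rewrite mxE ni Normc.normc0 expr0n.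
move=> _ [x /= x1 <-]; apply: le_trans (inner_shift_mx_le _ _ a_ge0) _.
by apply: le_trans (ar _) _; rewrite norm2_eq1 // mulr1.
Qed.

Lemma has_ubound_radius a s : (forall i, 0 <= a 0 i) ->
  has_ubound [set Normc.normc (inner (shift_mx a s *m x) x)
             | x in [set x : 'cV[R[i]]_6 | norm2 x = 1]]%classic.
Proof.
move=> a_ge0; exists (\sum_i a 0 (s i)) => _ [x /= x1 <-].
apply: le_trans (inner_shift_mx_le _ _ a_ge0) _; apply: ler_sum => i _.
have n_ge0 k : 0 <= Normc.normc (x k 0) by rewrite -ler0c normc_norm.
have n_le1 k : Normc.normc (x k 0) <= 1.
  rewrite -(@ler_sqr _ _ 1) ?nnegrE // expr1n -(norm2_eq1 x1) (bigD1 k) //=.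
  by rewrite lerDl sumr_ge0 // => j _; rewrite sqr_ge0.
by rewrite -mulrA ler_piMr // mulr_ile1.
Qed.

Lemma radius_bound a s : (forall i, 0 <= a 0 i) ->
  cycle_bound (fun i => a 0 (s i)) (numerical_radius (shift_mx a s)).
Proof.
move=> a_ge0 y; set w := numerical_radius _; set n2 := \sum_i _ ^+ 2.
have n2_ge0 : 0 <= n2 by apply: sumr_ge0 => i _; rewrite sqr_ge0.
have [n20|nz] := eqVneq n2 0.
  have y0 i : y i = 0.
    by apply/eqP; rewrite -sqrf_eq0; apply/eqP/(psumr_eq0P _ n20) => // k _;
      rewrite sqr_ge0.
  by rewrite n20 mulr0 big1 // => i _; rewrite y0 mulr0 mul0r.
have n2_gt0 : 0 < n2 by rewrite lt_neqAle eq_sym nz.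
pose n := Num.sqrt n2; have nE : n ^+ 2 = n2 by rewrite sqr_sqrtr.
pose x : 'cV[R[i]]_6 := \col_i (y i / n)%:C.
have xE i : x i 0 = (y i / n)%:C by rewrite mxE.
have x1 : norm2 x = 1.
  rewrite /norm2 (eq_bigr (fun i => y i ^+ 2 / n2)).
    by rewrite -mulr_suml divff // sqrtr1.
  move=> i _; rewrite xE /Normc.normc /= expr0n addr0 sqr_sqrtr ?sqr_ge0 //.
  by rewrite exprMn exprVn nE.
rewrite -ler_pdivrMr //.
have /ub_le_sup/(_ _ (imageP _ x1)) := has_ubound_radius s a_ge0.
apply: le_trans; rewrite inner_shift_mx.
rewrite (eq_bigr (fun i => (a 0 (s i) * y i * y (ordS i) / n2)%:C)); last first.
  move=> i _; rewrite !xE conj_Creal; last first.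
    by apply/complex_realP; exists (y i / n).
  by rewrite -!rmorphM /= -nE -exprVn; congr (_%:C); ring.
rewrite -rmorph_sum -mulr_suml -lecR normc_norm; apply: real_ler_norm.
by apply/complex_realP; eexists.
Qed.

End Radius.

(** * Exchanging two weights *)

Section Exchange.
Variable R : realType.
Implicit Types (a : 'rV[R]_6) (s h : 'S_6).

Definition weights a s : 'I_6 -> R := fun i => a 0 (s i).
Definition top_root a s : R := 4 * numerical_radius (shift_mx a s) ^+ 2.
Definition optimal a s := forall u, top_root a s <= top_root a u.

Lemma cubic_swap02 a s x : let b i := weights a s i ^+ 2 in
  cubic (weights a s) x - cubic (weights a (tperm [pos 0] [pos 2] * s)%g) x =
  (b [pos 0] - b [pos 2]) * (b [pos 3] - b [pos 5]) * x.
Proof. rewrite /cubic !sum6E /weights !permM /tperm !permE /=; ring. Qed.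

(** The right-hand side is written so that its sign can be read off when [x]
    is at least every squared weight. *)
Lemma cubic_swap03 a s x : let b i := weights a s i ^+ 2 in
  cubic (weights a s) x - cubic (weights a (tperm [pos 0] [pos 3] * s)%g) x =
  (b [pos 0] - b [pos 3]) *
  ((b [pos 2] - b [pos 5]) * (x - b [pos 4])
   + (b [pos 4] - b [pos 1]) * (x - b [pos 5])).
Proof. rewrite /cubic !sum6E /weights !permM /tperm !permE /=; ring. Qed.

Lemma cubic_H6 a h s x : h \in H6 ->
  cubic (weights a (h * s)%g) x = cubic (weights a s) x.
Proof.
move=> /gen_prodgP[n [g gH ->]]; elim: n g gH s => [|n IH] g gH s.
  by rewrite big_ord0 mul1g.
rewrite big_ord_recr /= -mulgA IH => [|i]; last exact: gH.
have [/set2P[|] ->] := gH ord_max.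
  have E : (c6 [pos 0] = [pos 5]) * (c6 [pos 1] = [pos 0]) *
           (c6 [pos 2] = [pos 1]) * (c6 [pos 3] = [pos 2]) *
           (c6 [pos 4] = [pos 3]) * (c6 [pos 5] = [pos 4]).
    by do !split; rewrite permE; apply: val_inj.
  by rewrite /cubic !sum6E /weights !permM !E; ring.
have E : (m6 [pos 0] = [pos 5]) * (m6 [pos 1] = [pos 4]) *
         (m6 [pos 2] = [pos 3]) * (m6 [pos 3] = [pos 2]) *
         (m6 [pos 4] = [pos 1]) * (m6 [pos 5] = [pos 0]).
  by do !split; rewrite permE; apply: val_inj.
by rewrite /cubic !sum6E /weights !permM !E; ring.
Qed.

Section Weights.
Variable a : 'rV[R]_6.
Hypothesis aA : A6 a.

Lemma A6_ge0 i : 0 <= a 0 i.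
Proof.
case: aA => a0 a_lt; have [->//|i0] := eqVneq i 0.
by apply/ltW/(le_lt_trans a0)/a_lt; rewrite lt0n.
Qed.

Lemma A6_ltr_sqr i j : (a 0 i ^+ 2 < a 0 j ^+ 2) = (i < j)%N.
Proof.
rewrite ltr_sqr ?nnegrE ?A6_ge0 //; have [ij|ji|/val_inj ->] := ltngtP i j.
- exact: aA.2.
- by apply/negbTE; rewrite -leNgt ltW //; exact: aA.2.
- exact: ltxx.
Qed.

Lemma weight_le_radius s k : a 0 k <= 2 * numerical_radius (shift_mx a s).
Proof.
rewrite -(permKV s k); apply: (weight_le_bound (c := weights a s)).
exact: radius_bound A6_ge0.
Qed.

Lemma radius_gt0 s : 0 < numerical_radius (shift_mx a s).
Proof.
rewrite -(pmulr_rgt0 _ (ltr0n R 2)).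
apply: lt_le_trans (weight_le_radius s [pos 5]).
by apply: le_lt_trans (A6_ge0 0) _; apply: aA.2.
Qed.

Lemma sqr_le_top_root s k : a 0 k ^+ 2 <= top_root a s.
Proof.
have -> : top_root a s = (2 * numerical_radius (shift_mx a s)) ^+ 2.
  by rewrite /top_root; ring.
rewrite ler_sqr ?nnegrE ?A6_ge0 ?weight_le_radius //.
by rewrite mulr_ge0 ?ler0n // ltW // radius_gt0.
Qed.

Lemma cubic_top_root s : cubic (weights a s) (top_root a s) = 0.
Proof.
apply: cubic_radius (radius_gt0 s) (radius_bound s A6_ge0) _ => r _.
exact: radius_le A6_ge0.
Qed.

Lemma le_top_root s t : cubic (weights a s) t <= 0 -> t <= top_root a s.
Proof. exact: cubic_le0_bound (radius_gt0 s) (radius_bound s A6_ge0). Qed.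

Lemma lt_top_root s t : cubic (weights a s) t < 0 -> t < top_root a s.
Proof.
move=> t_lt0; rewrite lt_neqAle le_top_root ?ltW // andbT.
by apply: contraTneq t_lt0 => ->; rewrite cubic_top_root ltxx.
Qed.

Lemma ler_top_root s u : (top_root a s <= top_root a u) =
  (numerical_radius (shift_mx a s) <= numerical_radius (shift_mx a u)).
Proof.
by rewrite ler_pM2l ?ltr0n // ler_sqr ?nnegrE // ltW // radius_gt0.
Qed.

Lemma top_root_cubic s u : cubic (weights a s) =1 cubic (weights a u) ->
  top_root a s = top_root a u.
Proof.
move=> E; apply/le_anti/andP; split; apply: le_top_root.
  by rewrite -E cubic_top_root.
by rewrite E cubic_top_root.
Qed.

Lemma top_root_H6 h s : h \in H6 -> top_root a (h * s)%g = top_root a s.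
Proof. by move=> hH; apply: top_root_cubic => x; exact: cubic_H6. Qed.

(** An exchange of two weights may leave the set of representatives, so
    optimality is first extended to the whole symmetric group. *)
Lemma optimal_S6modH6 s :
  (forall u, u \in S6modH6 -> top_root a s <= top_root a u) -> optimal a s.
Proof.
move=> s_min u; have /and3P[_ _ /forall_inP] := S6modH6_transversal.
have uU : (H6 :* u)%g \in rcosets H6 [set: 'S_6].
  by apply/rcosetsP; exists u; rewrite ?inE.
move=> /(_ _ uU)/cards1P[v /setP/(_ v)]; rewrite !inE eqxx => /andP[vS].
move=> /rcosetP[h hH vE]; rewrite -(top_root_H6 u hH) -vE; apply: s_min.
by rewrite inE.
Qed.

Lemma optimal_H6 h s : h \in H6 -> optimal a s -> optimal a (h * s)%g.
Proof. by move=> hH so u; rewrite top_root_H6. Qed.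

(** Cubics are compared at the largest root of the competitor [u]: where the
    cubic of [u] vanishes, a negative cubic for [s] means a larger root. *)
Lemma optimal_cubic s u : optimal a s ->
  ~~ (cubic (weights a s) (top_root a u)
      - cubic (weights a u) (top_root a u) < 0).
Proof.
move=> so; rewrite cubic_top_root subr0.
by apply: contraTN (so u) => /lt_top_root; rewrite -ltNge.
Qed.

Lemma optimal_pairs_sorted s : optimal a s ->
  (s [pos 0] < s [pos 2])%N = (s [pos 3] < s [pos 5])%N.
Proof.
move=> /optimal_cubic-/(_ (tperm [pos 0] [pos 2] * s)%g).
rewrite cubic_swap02; set x := top_root _ _.
have x_gt0 : 0 < x by rewrite mulr_gt0 ?ltr0n // exprn_gt0 // radius_gt0.
rewrite pmulr_llt0 // /weights.
have neq i j : i != j -> (s j < s i)%N = ~~ (s i < s j)%N.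
  move=> ij; rewrite -leqNgt [RHS]leq_eqVlt.
  by rewrite (inj_eq val_inj) (inj_eq perm_inj) eq_sym (negPf ij).
have [lt02|] := boolP (s [pos 0] < s [pos 2])%N.
  rewrite nmulr_rlt0 ?subr_lt0 ?A6_ltr_sqr // subr_gt0 A6_ltr_sqr neq //.
  by rewrite negbK => ->.
rewrite -neq // => lt20; rewrite pmulr_rlt0 ?subr_gt0 ?A6_ltr_sqr //.
by rewrite subr_lt0 A6_ltr_sqr => /negPf.
Qed.

Lemma optimal_same_side s : optimal a s ->
  ~~ [&& s [pos 3] < s [pos 0], s [pos 2] < s [pos 5]
       & s [pos 4] < s [pos 1]]%N
  && ~~ [&& s [pos 0] < s [pos 3], s [pos 5] < s [pos 2]
          & s [pos 1] < s [pos 4]]%N.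
Proof.
move=> /optimal_cubic-/(_ (tperm [pos 0] [pos 3] * s)%g).
rewrite cubic_swap03 /= /weights; set x := top_root _ _ => H.
have x_ge k : a 0 k ^+ 2 <= x by exact: sqr_le_top_root.
apply/andP; split; apply: contra H => /and3P[].
  rewrite -!A6_ltr_sqr => lt30 lt25 lt41.
  rewrite pmulr_rlt0 ?subr_gt0 //.
  have x5 := x_ge (s [pos 5]); have x4 := lt_le_trans lt41 (x_ge (s [pos 1])).
  rewrite -oppr_gt0 opprD ltr_pwDl // -mulNr ?opprB.
    by rewrite mulr_gt0 // subr_gt0.
  by rewrite mulr_ge0 // subr_ge0 // ltW.
rewrite -!A6_ltr_sqr => lt03 lt52 lt14.
rewrite nmulr_rlt0 ?subr_lt0 //.
have x4 := x_ge (s [pos 4]); have x5 := lt_le_trans lt52 (x_ge (s [pos 2])).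
rewrite addrC ltr_pwDl // ?mulr_gt0 ?subr_gt0 //.
by rewrite mulr_ge0 // subr_ge0 // ltW.
Qed.

End Weights.
End Exchange.

(** * From exchange conditions to Young tableaux *)

(** Permutations are turned into lists of numbers, on which the exchange
    conditions can be decided by computation. *)
Definition word (s : 'S_6) : seq nat := [seq val (s i) | i <- enum 'I_6].

Lemma nth_word s (i : 'I_6) : nth 0%N (word s) i = s i.
Proof. by rewrite (nth_map i) ?size_enum_ord // nth_ord_enum. Qed.

Lemma size_word s : size (word s) = 6%N.
Proof. by rewrite size_map size_enum_ord. Qed.

Lemma word_inj : injective word.
Proof.
by move=> s u E; apply/permP => i; apply: val_inj; rewrite /= -!nth_word E.
Qed.

Lemma word_permutation s : word s \in permutations (iota 0 6).
Proof.
have us : uniq (word s).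
  by rewrite map_inj_uniq ?enum_uniq // => i j /val_inj/perm_inj.
rewrite mem_permutations uniq_perm ?iota_uniq //.
apply: (uniq_min_size us _ _).2; last by rewrite size_iota size_word.
by move=> _ /mapP[i _ ->]; rewrite mem_iota /= add0n.
Qed.

Lemma word_rot2 s : word (c6 ^+ 4 * s)%g = rot 2 (word s).
Proof.
apply: (@eq_from_nth _ 0%N).
  by rewrite size_rot !size_word.
move=> i; rewrite size_word => i6.
rewrite (nth_word _ (Ordinal i6)) permM c6X.
have := size_word s.
rewrite -nth_word.
case: (word s) => [|w0 [|w1 [|w2 [|w3 [|w4 [|w5 [|//]]]]]]] // _.
by case: i i6 => [|[|[|[|[|[|//]]]]]].
Qed.

Lemma word_oneline s1 s2 s3 s4 s5 s6 :
  perm_eq [:: s1; s2; s3; s4; s5; s6] (iota 1 6) ->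
  word (oneline s1 s2 s3 s4 s5 s6) =
    [seq k.-1 | k <- [:: s1; s2; s3; s4; s5; s6]].
Proof.
move=> p; apply: (@eq_from_nth _ 0%N); first by rewrite size_word.
move=> i; rewrite size_word => i6.
rewrite (nth_word _ (Ordinal i6)) (nth_map 0%N) //.
by rewrite -(onelineE (Ordinal i6) p).
Qed.

Lemma S6modH6_word s : (s \in S6modH6) =
  (nth 0 (word s) 0 == 0)%N && (nth 0 (word s) 1 < nth 0 (word s) 5)%N.
Proof.
have E1 : 1 = [pos 1] by apply: val_inj.
have E5 : inord 5 = [pos 5] by apply: val_inj; rewrite /= inordK.
rewrite inE E1 E5 (nth_word s [pos 0]) (nth_word s [pos 1]) (nth_word s [pos 5]).
by have -> : 0 = [pos 0] by apply: val_inj.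
Qed.

(** The exchange conditions for the positions 0, 2 and for the positions 0, 3;
    rotating the word by two gives the conditions for the other pairs of
    positions. *)
Definition exchange_stable (l : seq nat) : bool :=
  let l_ i := nth 0%N l i in
  [&& (l_ 0 < l_ 2)%N == (l_ 3 < l_ 5)%N,
      ~~ [&& l_ 3 < l_ 0, l_ 2 < l_ 5 & l_ 4 < l_ 1]%N &
      ~~ [&& l_ 0 < l_ 3, l_ 5 < l_ 2 & l_ 1 < l_ 4]%N].

Definition tableau_words : seq (seq nat) :=
  [:: [:: 0; 4; 2; 3; 1; 5]; [:: 0; 3; 4; 2; 1; 5]; [:: 0; 4; 3; 2; 1; 5];
      [:: 0; 4; 3; 1; 2; 5]; [:: 0; 3; 4; 1; 2; 5]]%N.

Definition tableau_perms : seq 'S_6 :=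
  [:: oneline 1 5 3 4 2 6; oneline 1 4 5 3 2 6; oneline 1 5 4 3 2 6;
      oneline 1 5 4 2 3 6; oneline 1 4 5 2 3 6].

Lemma word_tableau_perms : [seq word s | s <- tableau_perms] = tableau_words.
Proof. by rewrite /= !word_oneline. Qed.

Lemma exchange_stable_words :
  all (fun l => [&& nth 0 l 0 == 0, nth 0 l 1 < nth 0 l 5, exchange_stable l,
                 exchange_stable (rot 2 l) & exchange_stable (rot 2 (rot 2 l))]
                ==> (l \in tableau_words))%N (permutations (iota 0 6)).
Proof. by vm_compute. Qed.

Lemma tableau_perms_S6modH6 s : s \in tableau_perms -> s \in S6modH6.
Proof.
rewrite S6modH6_word -(mem_map word_inj) word_tableau_perms.
by move: (word s); apply/allP.
Qed.

(** * The optimal permutations *)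

Section OptimalPermutations.
Variable R : realType.

Lemma optimal_exchange_stable (a : 'rV[R]_6) s :
  A6 a -> optimal a s -> exchange_stable (word s).
Proof.
move=> aA so; rewrite /exchange_stable.
rewrite (nth_word s [pos 0]) (nth_word s [pos 1]) (nth_word s [pos 2]).
rewrite (nth_word s [pos 3]) (nth_word s [pos 4]) (nth_word s [pos 5]).
by rewrite (optimal_pairs_sorted aA so) eqxx (optimal_same_side aA so).
Qed.

Lemma M6_sub s : M6 R s -> s \in tableau_perms.
Proof.
case=> sS [a [aA s_min]].
have so : optimal a s.
  by apply: (optimal_S6modH6 aA) => u uS; rewrite (ler_top_root aA); exact: s_min.
have cH k : (c6 ^+ k)%g \in H6 by rewrite groupX // mem_gen // finset.set21.
have so2 := optimal_H6 aA (cH 4) so; have so4 := optimal_H6 aA (cH 4) so2.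
have := allP exchange_stable_words _ (word_permutation s).
rewrite -!word_rot2 (optimal_exchange_stable aA so).
rewrite (optimal_exchange_stable aA so2) (optimal_exchange_stable aA so4).
rewrite !andbT -S6modH6_word sS implyTb.
by rewrite -word_tableau_perms (mem_map word_inj).
Qed.

(** By [M6_sub] the minimum over all representatives is attained among the five
    tableaux, so only these have to be compared. *)
Lemma M6_witness (a : 'rV[R]_6) t s : A6 a -> s \in tableau_perms ->
  (forall x, t <= x -> 0 < cubic (weights a s) x) ->
  (forall u, u \in tableau_perms -> u != s -> cubic (weights a u) t <= 0) ->
  M6 R s.
Proof.
move=> aA s5 s_gt0 u_le0; split; first exact: tableau_perms_S6modH6.
exists a; split; first exact: aA.
pose w (u : 'S_6) := numerical_radius (shift_mx a u).
have [v vS v_min] := arg_minP w (tableau_perms_S6modH6 s5).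
suff -> : s = v by exact: v_min.
have v5 : v \in tableau_perms.
  apply: M6_sub; split; first exact: vS.
  by exists a; split; [exact: aA | exact: v_min].
apply/eqP; rewrite eq_sym; apply: contraT => vs.
have /(le_top_root aA) tv := u_le0 v v5 vs.
have : top_root a v <= top_root a s.
  rewrite (ler_top_root aA); exact: v_min (tableau_perms_S6modH6 s5).
rewrite leNgt => /negP[]; apply: lt_le_trans tv; rewrite ltNge; apply/negP.
by move=> /s_gt0; rewrite (cubic_top_root aA) ltxx.
Qed.

Definition row6 (l : seq nat) : 'rV[R]_6 := \row_i (nth 0%N l i)%:R.

Lemma A6_row6 l : sorted ltn l -> size l = 6%N -> A6 (row6 l).
Proof.
move=> l_lt l6; split=> [|i j ij]; rewrite !mxE ?ler0n // ltr_nat.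
by rewrite (sorted_ltn_nth ltn_trans) ?inE ?l6.
Qed.

Lemma weights_row6 l s (i : 'I_6) :
  weights (row6 l) s i = (nth 0%N l (nth 0%N (word s) i))%:R.
Proof. by rewrite nth_word /weights mxE. Qed.

Definition word_cubic (l w : seq nat) : R -> R :=
  cubic (fun i => (nth 0%N l (nth 0%N w i))%:R).

(** Writing the half-line as [t + h] with [h >= 0] makes all coefficients in [h]
    positive in the applications below. *)
Lemma M6_nat_witness l t s : sorted ltn l -> size l = 6%N ->
  s \in tableau_perms ->
  (forall h, 0 <= h -> 0 < word_cubic l (word s) (t + h)) ->
  (forall w, w \in tableau_words -> w != word s -> word_cubic l w t <= 0) ->
  M6 R s.
Proof.
move=> l_lt l6 s5 s_gt0 u_le0.
apply: (M6_witness (A6_row6 l_lt l6) (t := t)) => //.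
  move=> x tx; have := s_gt0 (x - t); rewrite subr_ge0 addrC subrK => /(_ tx).
  by congr (0 < _); congr (cubic _ _); apply/funext => i; rewrite weights_row6.
move=> u u5 us; have := u_le0 (word u).
rewrite -word_tableau_perms !(inj_eq word_inj) map_f // us => /(_ isT isT).
by congr (_ <= 0); congr (cubic _ _); apply/funext => i; rewrite weights_row6.
Qed.

(** The numbers [t] lie in the gap between the squares of the two smallest
    operator norms of [A + A^T] over the five permutations.  For the last
    permutation the gap is narrow: two large and four small weights open it, and
    these have been rounded to integers. *)
Lemma tableau_separated s : s \in tableau_perms ->
  exists l, exists t : R, [/\ sorted ltn l, size l = 6%N,
    forall h, 0 <= h -> 0 < word_cubic l (word s) (t + h) &
    forall w, w \in tableau_words -> w != word s -> word_cubic l w t <= 0].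
Proof.
move=> s5.
have le0 l (t : R) : all (fun w => (w == word s) || (word_cubic l w t <= 0))
    tableau_words ->
  forall w, w \in tableau_words -> w != word s -> word_cubic l w t <= 0.
  by move=> /allP H w /H /orP[/eqP ->|//]; rewrite eqxx.
move: s5; rewrite !inE => /or4P[/eqP|/eqP|/eqP|/orP[]/eqP] sE;
  [ exists [:: 0; 1; 3; 4; 5; 6]%N, 43 | exists [:: 1; 2; 3; 4; 8; 11]%N, 128
  | exists [:: 0; 3; 4; 5; 6; 8]%N, 81 | exists [:: 0; 2; 6; 7; 8; 9]%N, 125
  | exists [:: 4; 5; 6; 9; 21; 22]%N, 600 ];
  split=> // [h h_ge0|].
1,3,5,7,9:
  have h2 := exprn_ge0 2 h_ge0; have h3 := exprn_ge0 3 h_ge0;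
  rewrite sE word_oneline // /word_cubic /cubic sum6E /=; lra.
all: apply: le0; rewrite sE word_oneline //= !andbT;
  rewrite /word_cubic /cubic !sum6E /=; do ![apply/andP; split]; lra.
Qed.

End OptimalPermutations.

Theorem theorem3p2 (R : realType) :
  M6 R = [set` [:: oneline 1 5 3 4 2 6;
                   oneline 1 4 5 3 2 6;
                   oneline 1 5 4 3 2 6;
                   oneline 1 5 4 2 3 6;
                   oneline 1 4 5 2 3 6]]%classic.
Proof.
rewrite -/tableau_perms; apply/seteqP; split=> s /=; first exact: M6_sub.
move=> s5; have [l [t [l_lt l6 s_gt0 w_le0]]] := tableau_separated R s5.
exact: M6_nat_witness l_lt l6 s5 s_gt0 w_le0.
Qed.
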